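(* For any odd positive integer $n$, we have $$\sum_{k=0}^{\frac{n-1}{2}}q^{k^2}\frac{(q;q^2)_k}{(q^4;q^4)_k}\equiv (-q)^{\frac{1-n^2}{8}}\pmod{\Phi_n(q)^2}.$$
   Context: Here $q$ is an indeterminate. The $q$-shifted factorial is defined by $(a;q)_m=(1-a)(1-aq)\cdots(1-aq^{m-1})$ for integers $m\geq 1$ and $(a;q)_0=1$; thus $(q;q^2)_k=\prod_{j=0}^{k-1}(1-q^{2j+1})$ and $(q^4;q^4)_k=\prod_{j=1}^{k}(1-q^{4j})$. $\Phi_n(q)$ denotes the $n$-th cyclotomic polynomial in $q$. Both sides of the congruence are rational functions of $q$. As is standard, for rational functions $A(q),B(q)\in\mathbb{Q}(q)$ and a polynomial $P(q)$, the congruence $A(q)\equiv B(q)\pmod{P(q)}$ means that $A(q)-B(q)$, written as a fraction of polynomials in lowest terms, has numerator divisible by $P(q)$ (and hence denominator coprime to $P(q)$). For odd $n$ the exponent $(1-n^2)/8$ is an integer. *)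

(* Defs.v *)
From HB Require Import structures.
From mathcomp Require Import all_boot all_order all_algebra all_field.

Set Implicit Arguments.
Unset Strict Implicit.
Unset Printing Implicit Defensive.

Import GRing.Theory.
Local Open Scope ring_scope.

Notation ratfun := {fraction {poly rat}}.

Definition qvar : ratfun := tofrac 'X.

Definition qshift (R : comNzRingType) (a q : R) (m : nat) : R :=
  \prod_(0 <= i < m) (1 - a * q ^+ i).

(* MathComp's 'Phi_n has integer coefficients. *)
Definition Phi (n : nat) : {poly rat} := map_poly intr 'Phi_n.

(* Lowest terms are unique up to a nonzero constant, so the choice of the
   representative num / den is immaterial. *)
Definition ratfun_congr (A B : ratfun) (P : {poly rat}) : Prop :=
  exists num den : {poly rat},
    [/\ den != 0, coprimep num den,
        A - B = tofrac num / tofrac den & P %| num].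

(* Main.v *)
(** Modulo Phi_n(q)^2 one may replace (q;q^2)_k^2 by
    (q^(1-n);q^2)_k (q^(1+n);q^2)_k, because the factors differ by multiples of
    (1 - q^n)^2, and (q;q^2)_k is invertible modulo Phi_n for k <= (n-1)/2.
    With p = q^2 and n = 2m+1 the sum becomes the case b = q of the
    q-analogue of Bailey's theorem
      sum_k p^(k(k-1)/2) b^k (p^-m;p)_k (p^(m+1);p)_k / ((p^2;p^2)_k (b;p)_k)
        = (b p^-m; p^2)_m / (b;p)_m,
    which follows by induction on m for all b simultaneously from a telescoping
    relation between (m, b) and (m-1, b p).  For b = q the quotient is a
    monomial, since the exponents 1-2m, 5-2m, ..., 2m-3 are, up to sign,
    exactly 1, 3, ..., 2m-1. *)
Require Import Defs.
From HB Require Import structures.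
From mathcomp Require Import all_boot all_order all_algebra all_field.
From mathcomp Require Import ring zify.

Set Implicit Arguments.
Unset Strict Implicit.
Unset Printing Implicit Defensive.

Import GRing.Theory.
Local Open Scope ring_scope.

(** * Recurrences for q-shifted factorials *)

Section QShift.
Variables (R : comNzRingType) (a q : R).

Lemma qshift0 : qshift a q 0 = 1.
Proof. by rewrite /qshift big_geq. Qed.

Lemma qshiftS m : qshift a q m.+1 = qshift a q m * (1 - a * q ^+ m).
Proof. by rewrite /qshift big_nat_recr. Qed.

Lemma qshiftSl m : qshift a q m.+1 = (1 - a) * qshift (a * q) q m.
Proof.
rewrite /qshift big_nat_recl //= expr0 mulr1; congr (_ * _).
by apply: eq_bigr => i _; rewrite exprS mulrA.
Qed.

End QShift.

Lemma rmorph_qshift (R S : comNzRingType) (f : {rmorphism R -> S}) a q m :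
  f (qshift a q m) = qshift (f a) (f q) m.
Proof.
rewrite /qshift rmorph_prod; apply: eq_bigr => i _.
by rewrite rmorphB rmorph1 rmorphM rmorphXn.
Qed.

(** * The exact summation: a q-analogue of Bailey's theorem *)

Section BaileySum.
Variables (F : fieldType) (p : F).
Hypothesis p_neq0 : p != 0.
Hypothesis p2_neq1 : forall i, 1 - p ^+ 2 * (p ^+ 2) ^+ i != 0.

Lemma qshift_neq0 (a q : F) m :
  (forall i, 1 - a * q ^+ i != 0) -> qshift a q m != 0.
Proof.
by move=> nz; elim: m => [|m IH]; rewrite ?qshift0 ?oner_eq0 // qshiftS mulf_neq0.
Qed.

(** Here [a] stands for p^-m, so that [p / a] is p^(m+1). Keeping [a] free makes the telescoping a
    rational identity in [a] and [b], with m specialised only afterwards. *)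
Definition bailey_term (a b : F) k :=
  p ^+ 'C(k, 2) * b ^+ k * (qshift a p k * qshift (p / a) p k)
  / (qshift (p ^+ 2) (p ^+ 2) k * qshift b p k).

(* The right-hand side is a q-Gosper antidifference.  At a = p^-m it vanishes
   for K >= m, leaving a first-order recurrence (m, b) -> (m - 1, b p). *)
Lemma bailey_telescope (a b : F) K : a != 0 -> (forall i, 1 - b * p ^+ i != 0) ->
  \sum_(0 <= k < K.+1) ((1 - b) * bailey_term a b k
      - (1 - a * b) * bailey_term (a * p) (b * p) k)
  = - (p ^+ 'C(K.+1, 2) * b ^+ K.+1 * (qshift a p K.+1 * qshift (p / a) p K)
       / (qshift (p ^+ 2) (p ^+ 2) K * qshift (b * p) p K)).
Proof.
move=> a0 b1.
have b0 : 1 - b != 0 by have := b1 0%N; rewrite expr0 mulr1.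
elim: K => [|K IH].
  rewrite big_nat1 /bailey_term qshiftS !qshift0 /=.
  by rewrite bin0n; field; rewrite oner_neq0.
rewrite big_nat_recr //= IH /bailey_term.
have -> : p / (a * p) = a^-1 by field; rewrite a0 p_neq0.
rewrite (qshiftSl a p K.+1) (qshiftSl a p K) (qshiftSl b) (qshiftSl a^-1).
rewrite (_ : a^-1 * p = p / a); last by rewrite mulrC.
rewrite !(qshiftS _ _ K) (binS K.+1) bin1 exprD !exprMn !exprS.
have : 1 - p ^+ 2 * (p ^+ 2) ^+ K != 0 by exact: p2_neq1.
have : 1 - b * p ^+ K.+1 != 0 by exact: b1.
have : qshift (b * p) p K != 0.
  by apply: qshift_neq0 => i; rewrite -mulrA -exprS; apply: b1.
have : qshift (p ^+ 2) (p ^+ 2) K != 0 by exact: qshift_neq0.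
rewrite exprAC !exprS !expr0 !mulr1.
move: (qshift _ _ _) (qshift _ _ _) (qshift _ _ _) (qshift _ _ _) => D C B A.
move: (p ^+ K) (b ^+ K) (p ^+ _) => Y bK pC D0 C0 bY pY.
by field; rewrite ?D0 ?C0 ?b0 ?a0 /=; move: bY pY; rewrite ?mulrA => -> ->.
Qed.

Lemma qshift_expV_eq0 m k : (m < k)%N -> qshift (p ^- m) p k = 0.
Proof.
move=> mk; rewrite /qshift (big_cat_nat (n := m.+1)) //= big_nat_recr //=.
by rewrite mulVf ?expf_neq0 // subrr mulr0 mul0r.
Qed.

Lemma bailey_sum m b : (forall i, 1 - b * p ^+ i != 0) ->
  \sum_(0 <= k < m.+1) bailey_term (p ^- m) b k
  = qshift (b / p ^+ m) (p ^+ 2) m / qshift b p m.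
Proof.
elim: m b => [|m IH] b b1.
  by rewrite big_nat1 /bailey_term !qshift0 bin0n !expr0 !mulr1.
have pn k : p ^+ k != 0 by rewrite expf_neq0.
have b0 : 1 - b != 0 by have := b1 0%N; rewrite expr0 mulr1.
have bp1 i : 1 - b * p * p ^+ i != 0 by rewrite -mulrA -exprS.
have aE : p ^- m.+1 * p = p ^- m.
  by rewrite exprS; field; rewrite pn p_neq0.
have := bailey_telescope m.+1 (invr_neq0 (pn m.+1)) b1.
(* The boundary term contains the zero factor 1 - p^-(m+1) p^(m+1). *)
rewrite qshift_expV_eq0 // mul0r mulr0 mul0r oppr0 sumrB -!mulr_sumr aE.
(* The second sum has first parameter p^-m, so its term k = m+1 vanishes and the rest is the
   induction hypothesis at b p. *)
rewrite [X in _ - _ * X]big_nat_recr //= [bailey_term _ _ m.+1]/bailey_term.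
rewrite qshift_expV_eq0 // mul0r mulr0 mul0r addr0 IH // => /eqP.
rewrite subr_eq0 => /eqP E; apply: (mulfI b0); rewrite {}E !qshiftSl.
have -> : b / p ^+ m.+1 * p ^+ 2 = b * p / p ^+ m.
  by rewrite exprS; field; rewrite pn p_neq0.
have : qshift (b * p) p m != 0 by exact: qshift_neq0.
by move=> nz; field; rewrite b0 nz pn.
Qed.

End BaileySum.

(** Induction from m to m+2: removing the first and last numerator factors, of exponents -(2m+3) and
    2m+1, leaves the numerator for m. Against the last two denominator factors they contribute
    -q^-(2m+3). *)
Lemma qshift_ratio (F : fieldType) (q : F) m : q != 0 ->
    (forall i, 1 - q * (q ^+ 2) ^+ i != 0) ->
  qshift (q / (q ^+ 2) ^+ m) (q ^+ 4) m / qshift q (q ^+ 2) m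
  = (- q) ^- 'C(m.+1, 2).
Proof.
move=> q0 q1.
have qn k : q ^+ k != 0 by rewrite expf_neq0.
elim/ltn_ind: m => -[|[|m]] IH.
- by rewrite !qshift0 bin_small // expr0 divr1 invr1.
- have := q1 0%N; rewrite !qshiftS !qshift0 binn !expr0 !expr1 !mulr1 !mul1r.
  by move=> q1'; field; rewrite oppr_eq0 q1' q0.
rewrite qshiftSl qshiftS !(qshiftS q).
have -> : q / (q ^+ 2) ^+ m.+2 * q ^+ 4 = q / (q ^+ 2) ^+ m.
  by rewrite -!exprM !mulnS !exprD; field; rewrite qn q0.
have -> : (- q) ^- 'C(m.+3, 2)
    = (- q) ^- 'C(m.+1, 2) / - (q ^+ 3 * q ^+ m ^+ 2).
  rewrite -invfM; congr (_^-1).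
  have <- : (- q) ^+ m * (- q) ^+ m = q ^+ m ^+ 2.
    by rewrite -exprMn mulrNN -expr2 exprAC.
  rewrite (binS m.+2) (binS m.+1) !bin1 !exprD !exprS.
  by ring.
rewrite -IH //.
have B0 : qshift q (q ^+ 2) m != 0 by exact: qshift_neq0.
move: (q1 m) (q1 m.+1) (qn m) B0 => c d Q0.
move: (qshift _ _ _) (qshift _ _ _) => A B B0; move: c d.
rewrite !(exprAC q 2) !(exprAC q 4) !(exprS q).
move: (q ^+ m) Q0 => Q Q0 c d.
by field; rewrite oppr_eq0 !mulf_neq0 ?expf_neq0 ?B0 ?c ?d ?Q0.
Qed.

Lemma bailey_sum_odd (F : fieldType) (q : F) m (a := q / q ^+ m.*2.+1) :
    q != 0 -> (forall j, (j > 0)%N -> 1 - q ^+ j != 0) ->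
  \sum_(0 <= k < m.+1)
     q ^+ (k ^ 2)%N * (qshift a (q ^+ 2) k * qshift (q ^+ 2 / a) (q ^+ 2) k)
     / (qshift (q ^+ 4) (q ^+ 4) k * qshift q (q ^+ 2) k)
  = (- q) ^- 'C(m.+1, 2).
Proof.
move=> q0 qj.
have q1 i : 1 - q * q ^+ 2 ^+ i != 0 by rewrite -exprM -exprS qj.
have q4 : q ^+ 2 ^+ 2 = q ^+ 4 by rewrite -exprM.
have q2 i : 1 - q ^+ 2 ^+ 2 * q ^+ 2 ^+ 2 ^+ i != 0.
  by rewrite q4 -exprS -exprM qj.
have aE : a = q ^+ 2 ^- m by rewrite /a exprS -mul2n exprM invfM mulVKf.
rewrite -(qshift_ratio m q0 q1) -q4 -(bailey_sum _ q2 m q1) ?expf_neq0 // -aE.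
apply: eq_bigr => k _; rewrite /bailey_term -(exprM q 2 'C(k, 2)) -exprD.
(* With p = q^2 and b = q the power of q is 2 C(k,2) + k = k^2. *)
by congr (q ^+ _ * _ / _); elim: k => // k IH; rewrite binS bin1; lia.
Qed.

(** * Divisibility of rational functions, localized away from P *)

Section LocalDivisibility.
Variable P : {poly rat}.
Hypothesis P_nonunit : size P != 1.

(* Divisibility by Q in the polynomial ring localized away from P. *)
Definition loc_dvd (Q : {poly rat}) (x : ratfun) :=
  exists num den : {poly rat},
    [/\ coprimep den P, x = tofrac num / tofrac den & Q %| num].

Lemma coprime_neq0 (f : {poly rat}) : coprimep f P -> f != 0.
Proof.
apply: contraTneq => ->; rewrite coprime0p -size_poly_eq1.
exact: P_nonunit.
Qed.

Lemma loc_dvd_poly (Q f : {poly rat}) : Q %| f -> loc_dvd Q (tofrac f).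
Proof. by exists f, 1; rewrite coprime1p tofrac1 divr1. Qed.

Lemma loc_dvdV (f : {poly rat}) : coprimep f P -> loc_dvd 1 (tofrac f)^-1.
Proof. by exists 1, f; rewrite tofrac1 div1r. Qed.

Lemma loc_dvdD Q x y : loc_dvd Q x -> loc_dvd Q y -> loc_dvd Q (x + y).
Proof.
move=> [a [b [bP -> Qa]]] [c [d [dP -> Qc]]].
exists (a * d + c * b), (b * d); split.
- by rewrite coprimepMl bP.
- by rewrite addf_div ?tofrac_eq0 ?coprime_neq0 // tofracD !tofracM.
- by rewrite dvdp_addr dvdp_mulr.
Qed.

Lemma loc_dvdM Q1 Q2 x y :
  loc_dvd Q1 x -> loc_dvd Q2 y -> loc_dvd (Q1 * Q2) (x * y).
Proof.
move=> [a [b [bP -> Qa]]] [c [d [dP -> Qc]]].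
exists (a * c), (b * d); split; last exact: dvdp_mul.
- by rewrite coprimepMl bP.
- by rewrite mulf_div !tofracM.
Qed.

Lemma loc_dvd_trans Q1 Q2 x : Q1 %| Q2 -> loc_dvd Q2 x -> loc_dvd Q1 x.
Proof.
move=> Q12 [a [b [bP -> Qa]]]; exists a, b.
by split=> //; apply: dvdp_trans Qa.
Qed.

Lemma loc_dvdMl Q x y : loc_dvd 1 x -> loc_dvd Q y -> loc_dvd Q (x * y).
Proof. by move=> x1 /(loc_dvdM x1); rewrite mul1r. Qed.

Lemma loc_dvdN Q x : loc_dvd Q x -> loc_dvd Q (- x).
Proof.
by move=> [a [b [bP -> Qa]]]; exists (- a), b; rewrite tofracN mulNr dvdpNr.
Qed.

Lemma loc_dvd_sum Q (F : nat -> ratfun) m :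
  (forall k, (k < m)%N -> loc_dvd Q (F k)) -> loc_dvd Q (\sum_(0 <= k < m) F k).
Proof.
move=> QF; rewrite big_nat; elim/big_ind: _ => [||k /andP[_ km]].
- by rewrite -tofrac0; apply: loc_dvd_poly.
- exact: loc_dvdD.
- exact: QF.
Qed.

Lemma coprimep_qshift (a q : {poly rat}) m :
  (forall i, (i < m)%N -> coprimep (1 - a * q ^+ i) P) ->
  coprimep (qshift a q m) P.
Proof.
move=> aqP; rewrite /qshift big_nat; elim/big_ind: _ => [||i /andP[_ im]].
- exact: coprime1p.
- by move=> f g fP gP; rewrite coprimepMl fP.
- exact: aqP.
Qed.

Lemma loc_dvd_congr A B e : loc_dvd (P ^+ e) (A - B) -> ratfun_congr A B (P ^+ e).
Proof.
move=> [a [b [bP AB Pa]]]; have b0 := coprime_neq0 bP.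
have g0 : gcdp a b != 0 by rewrite gcdp_eq0 negb_and b0 orbT.
have aE : a = a %/ gcdp a b * gcdp a b by rewrite divpK ?dvdp_gcdl.
have bE : b = b %/ gcdp a b * gcdp a b by rewrite divpK ?dvdp_gcdr.
exists (a %/ gcdp a b), (b %/ gcdp a b); split.
- by move: b0; rewrite {1}bE mulf_eq0 negb_or => /andP[].
- by rewrite coprimep_div_gcd ?b0 ?orbT.
- by rewrite AB {1}aE {3}bE !tofracM -mulf_div divff ?mulr1 ?tofrac_eq0.
(* The cancelled gcd divides [b], hence is coprime to P, so cancelling it keeps P^e in the
   numerator. *)
- move: Pa; rewrite {1}aE Gauss_dvdpl // coprimep_expl // coprimep_sym.
  exact: coprimep_dvdr (dvdp_gcdr a b) bP.
Qed.

End LocalDivisibility.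

(** * Coprimality and divisibility for cyclotomic polynomials *)

(** Coprimality is unchanged by extending scalars to [algC], where the roots of Phi_n are exactly
    the primitive n-th roots of unity. *)
Lemma coprimep_Phi n (f : {poly rat}) : (n > 0)%N ->
    (forall z : algC, n.-primitive_root z -> ~~ root (map_poly ratr f) z) ->
  coprimep f (Phi n).
Proof.
move=> n_gt0 fz; rewrite -(coprimep_map (ratr : rat -> algC)).
have [z prz] := C_prim_root_exists n_gt0.
have -> : map_poly ratr (Phi n) = cyclotomic z n.
  rewrite -(Cintr_Cyclotomic prz) /Phi -map_poly_comp.
  by apply: eq_map_poly => i /=; rewrite ratr_int.
rewrite coprimep_sym; apply/Pdiv.ClosedField.coprimepP => x.
by rewrite (root_cyclotomic prz) => /fz.
Qed.

Lemma coprimep_X_Phi n : (n > 0)%N -> coprimep 'X (Phi n).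
Proof.
move=> n_gt0; apply: coprimep_Phi => // z prz.
rewrite map_polyX rootX; apply: contra_eqN (prim_expr_order prz) => /eqP ->.
by rewrite expr0n gtn_eqF // eq_sym oner_eq0.
Qed.

Lemma coprimep_1subXn_Phi n j :
  (n > 0)%N -> ~~ (n %| j)%N -> coprimep (1 - 'X^j) (Phi n).
Proof.
move=> n_gt0 nj; apply: coprimep_Phi => // z prz.
rewrite rmorphB rmorph1 /= map_polyXn /root !hornerE.
by rewrite subr_eq0 eq_sym -(prim_order_dvd prz).
Qed.

Lemma Phi_dvd_1subXn n : (n > 0)%N -> Phi n %| 1 - 'X^n.
Proof.
move=> n_gt0; rewrite -dvdpNr opprB.
have -> : 'X^n - 1 = map_poly intr ('X^n - 1) :> {poly rat}.
  by rewrite rmorphB rmorph1 /= map_polyXn.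
rewrite -prod_Cyclotomic // (big_rem n) ?divisors_id //= rmorphM.
exact: dvdp_mulr.
Qed.

Lemma size_Phi n : (n > 0)%N -> size (Phi n) != 1.
Proof.
move=> n_gt0; rewrite size_map_inj_poly ?size_Cyclotomic //; last exact: intr_inj.
by rewrite eqSS -lt0n totient_gt0.
Qed.

(** * Termwise congruence modulo Phi_n(q)^2 *)

Lemma qvar_neq0 : qvar != 0.
Proof. by rewrite tofrac_eq0 polyX_eq0. Qed.

Lemma one_sub_qvar_neq0 j : (j > 0)%N -> 1 - qvar ^+ j != 0.
Proof.
move=> j_gt0; rewrite subr_eq0 eq_sym -subr_eq0 -tofrac1 -tofracXn -tofracB.
by rewrite tofrac_eq0 monic_neq0 // monicXnsubC.
Qed.

(* With r = q^n, Y = q^(2j): (1 - q^(1-n+2j)) (1 - q^(1+n+2j)) and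
   (1 - q^(1+2j))^2 agree up to a multiple of (1 - q^n)^2. *)
Lemma shifted_factors (F : fieldType) (q r Y : F) : q != 0 -> r != 0 ->
  (1 - q * Y) ^+ 2 - (1 - q / r * Y) * (1 - q ^+ 2 / (q / r) * Y)
  = r^-1 * (q * Y * (1 - r) ^+ 2).
Proof. by move=> q0 r0; field; rewrite r0 q0. Qed.

(** Product rule for adjoining one more factor. A B is written as U^2 - (U^2 - A B), so that its
    denominator is controlled by the induction hypothesis alone. *)
Lemma sqr_sub_prodM (R : comNzRingType) (U A B u a b : R) :
  (U * u) ^+ 2 - A * a * (B * b)
  = u ^+ 2 * (U ^+ 2 - A * B)
    + (U ^+ 2 - (U ^+ 2 - A * B)) * (u ^+ 2 - a * b).
Proof. by ring. Qed.

Lemma frac_sub_common (F : fieldType) (c U D W : F) : U != 0 -> D != 0 ->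
  c * (U / D) - c * W / (D * U) = c * (U^-1 * D^-1) * (U ^+ 2 - W).
Proof. by move=> U0 D0; field; rewrite D0. Qed.

Lemma qshift_sqr_congr n k (a := qvar / qvar ^+ n) : (n > 0)%N ->
  loc_dvd (Phi n) (Phi n ^+ 2)
    (qshift qvar (qvar ^+ 2) k ^+ 2
     - qshift a (qvar ^+ 2) k * qshift (qvar ^+ 2 / a) (qvar ^+ 2) k).
Proof.
move=> n_gt0; have P1 := size_Phi n_gt0.
elim: k => [|k IH].
  by rewrite !qshift0 expr1n mulr1 subrr -tofrac0; apply: loc_dvd_poly.
rewrite !qshiftS.
set U := qshift qvar _ k in IH *.
set A := qshift a _ k in IH *; set B := qshift (_ / a) _ k in IH *.
set Y := _ ^+ k.
have qn0 : qvar ^+ n != 0 by rewrite expf_neq0 ?qvar_neq0.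
have polyY : Y = tofrac ('X ^+ 2 ^+ k) by rewrite !tofracXn.
have polyU : U = tofrac (qshift 'X ('X ^+ 2) k).
  by rewrite rmorph_qshift /= tofracXn.
rewrite sqr_sub_prodM.
apply: loc_dvdD => //; apply: loc_dvdMl => //.
- by rewrite polyY -tofracM -tofrac1 -tofracB -tofracXn; apply/loc_dvd_poly/dvd1p.
- apply: loc_dvdD => //.
    by rewrite polyU -tofracXn; apply/loc_dvd_poly/dvd1p.
  by apply: loc_dvdN; apply: loc_dvd_trans IH; apply: dvd1p.
(* The factor q^-n is harmless because X is coprime to Phi_n; the square of 1 - q^n supplies
   Phi_n^2. *)
rewrite (shifted_factors _ qvar_neq0 qn0); apply: loc_dvdMl.
  by rewrite -tofracXn; apply/loc_dvdV; rewrite coprimep_expl ?coprimep_X_Phi.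
rewrite polyY -tofracXn -tofrac1 -tofracB -tofracXn -!tofracM.
by apply/loc_dvd_poly/dvdp_mull; rewrite dvdp_exp2r ?Phi_dvd_1subXn.
Qed.

Theorem theorem1p2 (n : nat) (n_odd : odd n) :
  ratfun_congr
    (\sum_(0 <= k < ((n - 1) %/ 2).+1)
       qvar ^+ (k ^ 2) * (qshift qvar (qvar ^+ 2) k
                          / qshift (qvar ^+ 4) (qvar ^+ 4) k))
    ((- qvar) ^ ((1 - n%:Z ^+ 2) %/ 8)%Z)
    (Phi n ^+ 2).
Proof.
have n_gt0 : (n > 0)%N by case: n n_odd.
have P1 := size_Phi n_gt0.
have [m nE] : exists m, n = m.*2.+1.
  by exists n./2; rewrite -[LHS]odd_double_half n_odd.
have -> : ((n - 1) %/ 2)%N = m by rewrite nE; lia.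
have -> : ((1 - n%:Z ^+ 2) %/ 8)%Z = - ('C(m.+1, 2))%:Z.
  have binE : ('C(m.+1, 2) * 2 = m.+1 * m)%N.
    by elim: m {nE} => // k IH; rewrite binS mulnDl IH bin1; lia.
  have -> : 1 - n%:Z ^+ 2 = - ('C(m.+1, 2))%:Z * 8 by rewrite nE; lia.
  by rewrite mulzK.
(* The monomial is expanded back into the exact sum, so the two sides can be compared term by
   term. *)
rewrite -exprnN -(bailey_sum_odd m qvar_neq0 one_sub_qvar_neq0) -nE.
apply: loc_dvd_congr => //; rewrite -sumrB; apply: loc_dvd_sum => // k.
rewrite ltnS => km.
have := qshift_sqr_congr k n_gt0.
set U := qshift qvar _ k; set D := qshift (qvar ^+ 4) _ k.
set AB := _ * qshift (_ / _) _ _; move=> dvdU.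
have UX : U = tofrac (qshift 'X ('X ^+ 2) k).
  by rewrite rmorph_qshift /= tofracXn.
have DX : D = tofrac (qshift ('X ^+ 4) ('X ^+ 4) k).
  by rewrite rmorph_qshift /= tofracXn.
(* Since i < k <= m, the exponents 2i+1 lie strictly between 0 and n. *)
have UP : coprimep (qshift 'X ('X ^+ 2) k) (Phi n).
  apply: coprimep_qshift => i ik.
  rewrite -exprM -exprS; apply: coprimep_1subXn_Phi => //.
  by rewrite gtnNdvd // nE; lia.
(* The exponents are 4(i+1) with 0 < i+1 <= m < n, and the odd n is coprime to 4. *)
have DP : coprimep (qshift ('X ^+ 4) ('X ^+ 4) k) (Phi n).
  apply: coprimep_qshift => i ik.
  rewrite -exprM -exprD; apply: coprimep_1subXn_Phi => //.
  have -> : (4 + 4 * i = 4 * i.+1)%N by lia.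
  rewrite Gauss_dvdr; last by rewrite (@coprimeXr 2 n 2) // coprimen2.
  by rewrite gtnNdvd // nE; lia.
have U0 : U != 0 by rewrite UX tofrac_eq0 (coprime_neq0 P1).
have D0 : D != 0 by rewrite DX tofrac_eq0 (coprime_neq0 P1).
rewrite (frac_sub_common _ _ U0 D0).
apply: loc_dvdMl => //; apply: loc_dvdMl.
  by rewrite -tofracXn; apply/loc_dvd_poly/dvd1p.
by rewrite UX DX; apply: loc_dvdMl; apply: loc_dvdV.
Qed.
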